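(* Let $f(\cdot)$ be a $\chi$-amenable graph parameter, let $g\ge 5$ be a fixed odd integer and let $\varepsilon>0$. Then for every sufficiently large $k\in\mathbb{N}$ (depending on $f$, $g$ and $\varepsilon$), every graph $G$ with $f(G)\ge \exp^{\left(\frac{g-3}{2}\right)}\bigl(k^{3+\varepsilon}\bigr)$ contains a subgraph $G'$ with $f(G')\ge k$ and odd-girth at least $g$.
   Context: All graphs are finite and simple. $\chi(G)$ denotes the chromatic number of $G$. Subgraphs need not be induced. The odd-girth of a graph is the length of its shortest odd cycle, and is $\infty$ if the graph has no odd cycle. For an integer $i\ge 0$, $\exp^{(i)}(\cdot)$ denotes the $i$-fold iterated exponential function: $\exp^{(0)}(x)=x$ and $\exp^{(i)}(x)=\exp(\exp^{(i-1)}(x))$ for $i\ge 1$. $\mathbb{N}=\{1,2,\ldots\}$. A graph parameter is a function $f$ assigning to every finite graph $G$ a non-negative real number $f(G)$. For graphs $G_1,G_2$ on the same vertex-set $V$, $G_1\cup G_2$ is the graph with vertex-set $V$ and edge-set $E(G_1)\cup E(G_2)$. A graph parameter $f$ is called $\chi$-amenable if the following two conditions are satisfied: (1) For every two graphs $G_1$ and $G_2$ on the same vertex-set, $f(G_1\cup G_2)\le f(G_1)f(G_2)$. (2) There exists an absolute constant $C\ge 1$ such that every graph $G$ has a subgraph $G'\subseteq G$ with $f(G')\ge f(G)/C$ and $\chi(G')\le Cf(G')$. *)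

(* Defs.v *)
From mathcomp Require Import all_boot all_order all_algebra.
From mathcomp Require Import all_classical all_reals all_analysis.

Set Implicit Arguments.
Unset Strict Implicit.
Unset Printing Implicit Defensive.

Import Order.TTheory GRing.Theory Num.Theory.

Local Open Scope ring_scope.

(* A graph carries its own vertex set inside an ambient finite type [T], so that
   subgraphs with fewer vertices are again graphs over [T], and "same vertex set"
   and "subgraph" are literal rather than up to isomorphism. *)
Record graph (T : finType) := Graph {
  vset : {set T};
  eset : {set {set T}};
  esetP : [forall e in eset, (e \subset vset) && (#|e| == 2)]
}.

Definition adj (T : finType) (G : graph T) : rel T :=
  fun x y => [set x; y] \in eset G.

Definition subgraph (T : finType) (H G : graph T) : Prop :=
  vset H \subset vset G /\ eset H \subset eset G.

Lemma union_esetP (T : finType) (G1 G2 : graph T) :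
  [forall e in eset G1 :|: eset G2,
     (e \subset vset G1 :|: vset G2) && (#|e| == 2)].
Proof.
apply/forall_inP => e; rewrite inE => /orP[] eG.
- have /andP[eV ->] := forall_inP (esetP G1) _ eG.
  by rewrite andbT (fintype.subset_trans eV) // finset.subsetUl.
- have /andP[eV ->] := forall_inP (esetP G2) _ eG.
  by rewrite andbT (fintype.subset_trans eV) // finset.subsetUr.
Qed.

Definition graph_union (T : finType) (G1 G2 : graph T) : graph T :=
  Graph (union_esetP G1 G2).

(* Only the vertices of [G] are coloured, not all of [T]. *)
Definition colorable (T : finType) (G : graph T) (n : nat) : bool :=
  [exists c : {ffun {x : T | x \in vset G} -> 'I_n},
     [forall x, forall y, adj G (val x) (val y) ==> (c x != c y)]].

Lemma adj_irrefl (T : finType) (G : graph T) : irreflexive (adj G).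
Proof.
move=> x; apply/negP => xx.
by have /andP[_] := forall_inP (esetP G) _ xx; rewrite finset.setUid cards1.
Qed.

Lemma colorable_ex (T : finType) (G : graph T) : exists n, colorable G n.
Proof.
exists #|{: {x : T | x \in vset G}}|; apply/existsP.
exists [ffun x => enum_rank x]; apply/forallP => x; apply/forallP => y.
apply/implyP => xy; rewrite !ffunE; apply/negP => /eqP /enum_rank_inj exy.
by move: xy; rewrite exy adj_irrefl.
Qed.

Definition chi (T : finType) (G : graph T) : nat := ex_minn (colorable_ex G).

Definition is_cycle (T : finType) (G : graph T) (c : seq T) : bool :=
  [&& 3 <= size c, uniq c & cycle (adj G) c]%N.

(* The infimum of the empty set in [\bar R] is [+oo]. *)
Definition odd_girth (R : realType) (T : finType) (G : graph T) : \bar R :=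
  ereal_inf
    [set ((size c)%:R)%:E | c in [set c | is_cycle G c && odd (size c)]]%classic.

(* Invariance under isomorphism is not required. *)
Record graph_parameter (R : realType) := GraphParameter {
  gp_fun :> forall T : finType, graph T -> R;
  gp_ge0 : forall (T : finType) (G : graph T), 0 <= gp_fun G
}.

Definition chi_amenable (R : realType) (f : graph_parameter R) : Prop :=
  (forall (T : finType) (G1 G2 : graph T), vset G1 = vset G2 ->
     f T (graph_union G1 G2) <= f T G1 * f T G2) /\
  (exists C : R, 1 <= C /\
     forall (T : finType) (G : graph T), exists G' : graph T,
       [/\ subgraph G' G, f T G / C <= f T G' & (chi G')%:R <= C * f T G']).

Definition iter_exp (R : realType) (i : nat) (x : R) : R := iter i expR x.

(* Main.v *)
Require Import Defs.
From mathcomp Require Import all_boot all_order all_algebra.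
From mathcomp Require Import all_classical all_reals all_analysis.
From mathcomp Require Import zify ring lra.
(* Last, so that [set0], [setT], [setP] and the like mean finite sets. *)
From mathcomp Require Import fintype finset.

Import Order.TTheory GRing.Theory Num.Theory Num.Def.

Set Implicit Arguments.
Unset Strict Implicit.
Unset Printing Implicit Defensive.

(** Only a statement about colouring the edges of a complete graph has to be
proved.  Replace [G] by the subgraph [H] of condition (2), so that
[M = f H >= f G / C] and [chi H <= C * M], and label [H] properly with
[N >= C * M] labels.  Suppose that the pairs of labels can be coloured with
[T] colours so that no colour class has an odd closed walk shorter than [g]
([has_long_coloring N T g]).  Pulled back along the labelling, the classes
split [H] into [T] graphs of odd girth at least [g], and by condition (1) the
product of their [f]-values is at least [M].  If [k ^ T < M], one of these
values is at least [k] ([exists_long_class]).  So colourings are wanted with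
[ln N] larger than [T * ln k] by a constant factor; [few_long_classes]
provides them.

One colour does for [g = 3], and a colouring of [N] vertices with [T] colours
gives one of [N ^ a] vertices with [a * T] colours, by looking at the first
coordinate in which two words differ.  What remains is to go from [g] to
[g + 2] ([recoloring]).  The new vertices are words of length [n] over the old
vertices, now called labels, and the new colour of [{u, v}] is a position [i]
with [u i != v i] together with the old colour of [{u i, v i}].  Hence the
walks of a new class project to walks of an old one, and a closed walk of the
same odd length [g] has to be excluded.  On such a walk the labels at position
[i] are all distinct, for otherwise it would split into two closed walks, one
of them odd and too short.

The position [i] is chosen by a hat-guessing game.  Let [j] be the largest
label for which the sets [A] and [B] of positions where [u] and [v] have label
[j] differ.  Seeing [u], one team guesses the letters of [v] on [A] minus [B],
and, seeing [v], the other team guesses the letters of [u] on [B] minus [A].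
If both differences are large, there are strategies, depending only on [A]
and [B], with one correct guess in every situation ([hat_strategies]); [i] is
the position of such a guess.  Say that it is in [A] minus [B].  Then
[u i = j], [v i < j], and [v i] is determined by [u], [A] and [B].  On a closed
walk of the class of [i], take the vertex [u] with the largest label [j] at
[i].  Along the rest of the walk all labels at [i] are smaller than [j], so
the set of positions with label [j] does not change there.  The two neighbours
of [u] on the walk thus present the same [B], so both have the same guessed
letter at [i], against distinctness.

The game needs about [(N * ln N) ^ 2] positions on either side, so the words
are taken from a code in which the sets compared above are equal or differ by
that much ([exists_code]).  With [n] about [N ^ 3] (up to logarithms and
constants) such a code still has [N ^ ((1 - d) * n)] words, so a step
multiplies [ln N] by nearly the same factor [n] as [T], and it turns [ln N]
into about [N ^ 3 * ln N], hence one exponential per step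
([long_coloring_growth], [long_coloring_tower]). *)
(** * A hat-guessing game *)
Lemma card_ffun_maps (X Y : finType) (Z : {set X}) (A : {set Y}) :
  #|[set p : {ffun X -> Y} | [forall x in Z, p x \in A]]| =
  #|A| ^ #|Z| * #|Y| ^ (#|X| - #|Z|).
Proof.
pose F := fun x : X => if x \in Z then pred_of_set A else predT.
have -> : #|[set p : {ffun X -> Y} | [forall x in Z, p x \in A]]| = #|family F|.
  apply: eq_card => p; rewrite !inE; apply/forall_inP/familyP => [pZ x | pF x xZ].
    by rewrite /F; case: ifP => // /pZ.
  by have := pF x; rewrite /F xZ.
rewrite card_family foldrE big_map big_enum /= (bigID (mem Z)) /=.
rewrite (eq_bigr (fun=> #|A|)) => [|x xZ]; last by rewrite /F xZ.
rewrite [X in _ * X](eq_bigr (fun=> #|Y|)) => [|x /negPf xZ]; last first.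
  by rewrite /F xZ; apply: eq_card.
rewrite !prod_nat_const; congr (_ * _ ^ _).
by rewrite -(cardsC Z) addKn; apply: eq_card => x; rewrite !inE.
Qed.

Lemma card_avoid K h (y : {ffun 'I_h -> 'I_K}) :
  #|[set z : {ffun 'I_h -> 'I_K} | [forall i, z i != y i]]| = K.-1 ^ h.
Proof.
pose F := fun i : 'I_h => predC1 (y i).
have -> : #|[set z : {ffun 'I_h -> 'I_K} | [forall i, z i != y i]]| = #|family F|.
  apply: eq_card => z; rewrite !inE; apply/forallP/familyP => // zy i.
rewrite card_family foldrE big_map big_enum /=.
rewrite (eq_bigr (fun=> K.-1)) ?prod_nat_const ?card_ord // => i _.
by have := cardC1 (y i); rewrite card_ord.
Qed.

(** The union bound for [exists_rarely_missing]: there are [K ^ h] words [y] and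
at most [(K ^ m) ^ m.+1] lists of [m.+1] words [x], and a random [p x] avoids
[y] everywhere with probability [(K.-1 / K) ^ h], independently for distinct
[x]. *)
Definition hat_bound K m h :=
  K ^ (h + m * m.+1) * K.-1 ^ (h * m.+1) < K ^ (h * m.+1).

(** The first team guesses [p x] on seeing [x].  It fails completely against [y]
exactly when [p x] and [y] disagree everywhere; a random [p] makes this happen
for so few [x] that the second team can have one player for each of them. *)
Lemma exists_rarely_missing K m h :
  1 < K -> hat_bound K m h ->
  exists p : {ffun 'I_m -> 'I_K} -> {ffun 'I_h -> 'I_K},
    forall y : {ffun 'I_h -> 'I_K}, #|[set x | [forall i, p x i != y i]]| <= m.
Proof.
move=> K1 small.
pose X := {ffun 'I_m -> 'I_K}; pose Y := {ffun 'I_h -> 'I_K}.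
have cX : #|{: X}| = K ^ m by rewrite card_ffun !card_ord.
have cY : #|{: Y}| = K ^ h by rewrite card_ffun !card_ord.
pose A (y : Y) := [set z : Y | [forall i, z i != y i]].
(* The maps [p] all of whose values on the range of the list avoid [y]. *)
pose bad (yZ : Y * {ffun 'I_m.+1 -> X}) : {set {ffun X -> Y}} :=
  if injectiveb yZ.2 then
    [set p : {ffun X -> Y} | [forall x in yZ.2 @: setT, p x \in A yZ.1]]
  else set0.
have [allbad | /forallPn [p pgood]] :=
  boolP [forall p, p \in \bigcup_yZ bad yZ]; last first.
  exists p => y; rewrite leqNgt; apply/negP => big.
  have [Z injZ ZA] : exists2 Z : {ffun 'I_m.+1 -> X}, injective Z &
      forall j, Z j \in [set x | [forall i, p x i != y i]].
    exists [ffun j : 'I_m.+1 => enum_val (widen_ord big j)].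
      by move=> j k; rewrite !ffunE => /enum_val_inj /(congr1 val) /= /val_inj.
    by move=> j; rewrite ffunE enum_valP.
  case/negP: pgood; apply/bigcupP; exists (y, Z) => //.
  rewrite /bad /=; have -> : injectiveb Z by apply/injectiveP.
  rewrite inE; apply/forall_inP => x /imsetP[j _ ->].
  by have := ZA j; rewrite !inE.
have badle yZ : #|bad yZ| <= K.-1 ^ (h * m.+1) * (K ^ h) ^ (K ^ m - m.+1).
  rewrite /bad; case: ifP => [/injectiveP injZ | _]; last by rewrite cards0.
  by rewrite card_ffun_maps card_imset // cardsT card_ord card_avoid cX cY expnM.
have unionle : #|\bigcup_yZ bad yZ| <= \sum_yZ #|bad yZ|.
  elim/big_rec2: _ => [|yZ n B _ leB]; first by rewrite cards0.
  by rewrite (leq_trans (leq_card_setU _ _)) // leq_add2l.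
have : (K ^ h) ^ (K ^ m) <= \sum_yZ #|bad yZ|.
  rewrite -{1}cX -cY -card_ffun; apply: leq_trans unionle.
  by rewrite -cardsT; apply/subset_leq_card/subsetP => p _; exact: (forallP allbad).
move=> cover; exfalso; move: cover.
rewrite leqNgt => /negP[].
have := leq_sum (index_enum _) (fun yZ (_ : predT yZ) => badle yZ).
move=> le; apply: leq_ltn_trans le _.
rewrite sum_nat_const card_prod cY card_ffun cX card_ord.
have mX : m.+1 <= K ^ m by exact: ltn_expl.
rewrite mulnA -[X in _ < (K ^ h) ^ X](subnKC mX) expnD ltn_pmul2r; last first.
  by rewrite !expn_gt0 (ltnW K1).
by rewrite -!expnM -expnD.
Qed.

(** The team on [A :\: B] plays [p] of [exists_rarely_missing], applied to what
it sees on [B :\: A].  If all its guesses fail, the letters on [B :\: A] form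
one of at most [m] words that the other team can list, since it sees the
letters on [A :\: B]; its player number [t] bets on letter [t] of the word
number [t] of the list, and the right word is somewhere in the list. *)
Lemma hat_strategies (I : finType) K m h (A B : {set I}) :
  1 < K -> hat_bound K m h ->
  h <= #|A :\: B| -> m <= #|B :\: A| ->
  exists P Q : {ffun I -> 'I_K} -> I -> 'I_K,
    forall u v : {ffun I -> 'I_K},
    (exists2 i, i \in A :\: B & v i = P u i) \/
    (exists2 i, i \in B :\: A & u i = Q v i).
Proof.
move=> K1 small hA mB.
have [p p_rare] := exists_rarely_missing K1 small.
pose pl (t : 'I_h) : I := enum_val (widen_ord hA t).
pose ql (t : 'I_m) : I := enum_val (widen_ord mB t).
have pl_inj : injective pl by move=> s t /enum_val_inj/(congr1 val)/= /val_inj.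
have ql_inj : injective ql by move=> s t /enum_val_inj/(congr1 val)/= /val_inj.
pose x (u : {ffun I -> 'I_K}) := [ffun t => u (ql t)].
pose y (v : {ffun I -> 'I_K}) := [ffun t => v (pl t)].
(* The words [z] on which the first team is wrong everywhere, given [v]. *)
pose missed v := enum [set z | [forall i, p z i != y v i]].
exists (fun u i => if [pick t | pl t == i] is Some t then p (x u) t else u i).
exists (fun v i => if [pick t | ql t == i] is Some t
                   then nth (x v) (missed v) t t else v i) => u v.
have [/forallP miss | /forallPn[t /negPn/eqP pt]] :=
  boolP [forall t, p (x u) t != y v t].
- right; have xu : x u \in missed v.
    by rewrite mem_enum inE; apply/forallP.
  have tm : index (x u) (missed v) < m.
    by apply: leq_trans (p_rare (y v)); rewrite cardE index_mem.
  pose t := Ordinal tm; exists (ql t); first exact: enum_valP.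
  case: pickP => [t' /eqP/ql_inj -> | /(_ t)]; last by rewrite eqxx.
  by rewrite /t /= nth_index // ffunE.
- left; exists (pl t); first exact: enum_valP.
  case: pickP => [t' /eqP/pl_inj -> | /(_ t)]; last by rewrite eqxx.
  by rewrite pt ffunE.
Qed.

(** * Words whose label sets are equal or far apart *)
Lemma greedy_coloring (X : finType) (e : rel X) d :
  symmetric e -> irreflexive e -> (forall x, #|[set y | e x y]| <= d) ->
  exists c : X -> 'I_d.+1, forall x y, e x y -> c x != c y.
Proof.
move=> eC eI deg.
suff [c cP] : exists c : X -> 'I_d.+1,
    {in enum X &, forall x y, e x y -> c x != c y}.
  by exists c => x y; apply: cP; rewrite mem_enum.
elim: (enum X) => [|a s [c cP]]; first by exists (fun=> ord0).
pose used := [set c y | y in [set y | e a y]].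
have [k kP] : exists k, k \notin used.
  apply/existsP; rewrite -negb_forall; apply/negP => /forallP all_used.
  have : #|'I_d.+1| <= #|used| by apply/subset_leq_card/subsetP => k _.
  by rewrite card_ord leqNgt ltnS (leq_trans (leq_imset_card _ _)).
have ka y : e a y -> k != c y.
  by move=> ay; apply: contraNneq kP => ->; apply/imsetP; exists y; rewrite ?inE.
exists (fun x => if x == a then k else c x) => x y; rewrite !inE.
case: (eqVneq x a) => [->|xa] /= xs; case: (eqVneq y a) => [->|ya] /= ys.
- by rewrite eI.
- exact: ka.
- by rewrite eC eq_sym => /ka.
- exact: cP.
Qed.

(** A set of at most [d] elements is the range of a word of length [d] in
[option I], where [None] fills the unused places. *)
Lemma card_small_sets (I : finType) d :
  #|[set S : {set I} | #|S| <= d]| <= #|I|.+1 ^ d.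
Proof.
rewrite -card_option -[d in leqRHS]card_ord -card_ffun.
pose g (f : {ffun 'I_d -> option I}) := [set i | [exists t, f t == Some i]].
rewrite -cardsT; apply: leq_trans (leq_imset_card g setT).
apply/subset_leq_card/subsetP => S; rewrite inE => Sd.
apply/imsetP; exists [ffun t : 'I_d => onth (enum S) t] => //.
apply/setP => i; rewrite inE; apply/idP/existsP => [iS | [t]].
  have it : index i (enum S) < d.
    by apply: leq_trans Sd; rewrite cardE index_mem mem_enum.
  exists (Ordinal it); rewrite ffunE /= onthE (nth_map i) ?index_mem ?mem_enum //.
  by rewrite nth_index ?mem_enum.
rewrite ffunE => /eqP tS; rewrite -mem_enum -(onth_nth i i _ _ tS).
by apply: mem_nth; rewrite -onthTE tS.
Qed.

Definition label_set (I : finType) N (w : {ffun I -> 'I_N}) (j : 'I_N) :=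
  [set i | w i == j].

Definition spread (I : finType) N h (V : {set {ffun I -> 'I_N}}) :=
  {in V &, forall u v j, label_set u j = label_set v j \/
     h <= #|label_set u j :\: label_set v j| /\
     h <= #|label_set v j :\: label_set u j|}.

(** Pigeonhole on syndromes.  Colour the subsets of [I] greedily so that distinct
sets at distance at most [2 h] get different colours.  Sets of the same colour
and the same cardinality are equal or have symmetric difference larger than
[2 h], split evenly by the equality of cardinalities.  So it suffices to fix
the colour and the cardinality of each of the [N] label sets. *)
Lemma exists_code (I : finType) N h : 0 < #|I| ->
  exists V : {set {ffun I -> 'I_N}},
    N ^ #|I| <= #|V| * (#|I|.+1 ^ h.*2.+2) ^ N /\
    spread h V.
Proof.
move=> I0; pose n := #|I|.
pose dif (A B : {set I}) := (A :\: B) :|: (B :\: A).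
have difC A B : dif A B = dif B A by rewrite /dif setUC.
have difK A B : dif A (dif A B) = B.
  by apply/setP => i; rewrite !inE; case: (i \in A); case: (i \in B).
pose e (A B : {set I}) := (A != B) && (#|dif A B| <= h.*2).
have [||A|c cP] := @greedy_coloring _ e (n.+1 ^ h.*2).
- by move=> A B; rewrite /e eq_sym difC.
- by move=> A; rewrite /e eqxx.
- apply: leq_trans (card_small_sets I h.*2).
  rewrite -(card_imset _ (can_inj (difK A))); apply/subset_leq_card/subsetP => S.
  by case/imsetP => B; rewrite !inE => /andP[_ ?] ->.
pose syn (A : {set I}) := (inord #|A| : 'I_n.+1, c A).
have synP A B : syn A = syn B -> A = B \/ h <= #|A :\: B| /\ h <= #|B :\: A|.
  case=> /(congr1 val) /=; rewrite !inordK ?ltnS ?max_card // => cardAB cAB.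
  have [->|AB] := eqVneq A B; [by left | right].
  have : ~~ e A B by apply/negP => /cP; rewrite cAB eqxx.
  rewrite /e AB -ltnNge /dif cardsU.
  have -> : (A :\: B) :&: (B :\: A) = set0.
    by apply/setP => i; rewrite !inE; case: (i \in A); case: (i \in B).
  rewrite cards0 subn0 => big.
  have := cardsID B A; have := cardsID A B; rewrite setIC; lia.
pose X := {ffun I -> 'I_N}.
pose Syn (w : X) := [ffun j => syn (label_set w j)].
pose fib y := [set w : X | Syn w == y].
have [->|N0] := posnP N.
  exists set0; split=> [|u v]; last by rewrite inE.
  by rewrite exp0n.
pose w0 : X := [ffun=> Ordinal N0].
case: (@arg_maxnP _ (Syn w0) predT (fun y => #|fib y|)) => // y _ ymax.
exists (fib y); split; last first.
  move=> u v; rewrite !inE => /eqP uy /eqP vy j; apply: synP.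
  by have := congr1 (fun f : {ffun _} => f j) (etrans uy (esym vy)); rewrite !ffunE.
have -> : N ^ n = #|{: X}| by rewrite card_ffun card_ord.
have -> : #|{: X}| = \sum_y #|fib y|.
  rewrite -sum1_card (partition_big Syn predT) //=; apply: eq_bigr => z _.
  by rewrite -sum1_card; apply: eq_bigl => w; rewrite inE.
apply: leq_trans (leq_sum _ (fun z _ => ymax z isT)) _.
rewrite sum_nat_const mulnC leq_mul2l card_ffun card_prod !card_ord.
rewrite leq_exp2r //; apply/orP; right.
have n2 : 1 < n.+1 by rewrite ltnS.
have p0 : 0 < n.+1 ^ h.*2 by rewrite expn_gt0.
rewrite !expnS leq_mul2l; apply: leq_trans (leq_mul n2 (leqnn _)); rewrite -/n; move: (n.+1 ^ h.*2) p0 => p p0; lia.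
Qed.

(** * Edge colourings without short odd closed walks *)
(** Closed walks may repeat vertices, unlike cycles: this makes the condition
pull back along every homomorphism. *)
Definition odd_walks_long (X : Type) (e : rel X) g :=
  forall s, cycle e s -> odd (size s) -> g <= size s.

Lemma odd_walks_long_hom (X Y : Type) (e : rel X) (e' : rel Y) (h : X -> Y) g :
  {homo h : x y / e x y >-> e' x y} ->
  odd_walks_long e' g -> odd_walks_long e g.
Proof.
move=> he long s es ods; rewrite -(size_map h).
by apply: long; rewrite ?size_map //; apply: homo_cycle he _ es.
Qed.

(** At a repeated vertex the walk splits into two closed walks, one of them odd
and shorter. *)
Lemma shortest_odd_walk_uniq (X : eqType) (e : rel X) g s :
  odd_walks_long e g -> cycle e s -> odd (size s) -> size s <= g -> uniq s.
Proof.
move=> long es ods sg.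
have once x p : rot (index x s) s = x :: p -> x \notin p.
  move=> es'; apply/negP => /splitPr xp; case: xp es' => p1 p2 rots.
  have /= := es; rewrite -(rot_cycle (index x s)) rots /= rcons_cat cat_path.
  rewrite rcons_cons /= => /and3P[xp1 px xp2].
  have sz : size s = (size p1).+1 + (size p2).+1.
    by rewrite -(size_rot (index x s)) rots /= size_cat.
  have /implyP l1 : odd (size p1).+1 ==> (g <= (size p1).+1).
    by apply/implyP => od; apply: (long (x :: p1)); rewrite //= rcons_path xp1.
  have /implyP l2 : odd (size p2).+1 ==> (g <= (size p2).+1).
    by apply/implyP => od; apply: (long (x :: p2)).
  move: ods sg; rewrite sz oddD; lia.
apply/count_mem_uniq => x; have [xs|] := boolP (x \in s); last by move/count_memPn.
have rx := rot_index xs; have /count_memPn c0 := once _ _ rx.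
have <- : count_mem x (rot (index x s) s) = count_mem x s by apply/permP; rewrite perm_rot.
by rewrite rx /= eqxx c0.
Qed.

(** The girth step.  Here [E] is a class with fixed position [i], and [F u v]
says that the guess at [i] is made by the team that sees [u].  The point is
that a vertex [u] carrying the largest label dictates the same letter at [i]
to both its neighbours on the walk. *)
Lemma recolored_walks_long (I : finType) N g (i : I)
    (D : rel 'I_N) (E F : rel {ffun I -> 'I_N})
    (st : {set I} -> {set I} -> {ffun I -> 'I_N} -> I -> 'I_N) :
  odd g -> odd_walks_long D g ->
  (forall u v, E u v -> D (u i) (v i)) ->
  (forall u v, E u v -> F u v \/ F v u) ->
  (forall u v, F u v ->
     [/\ v i < u i, forall l : 'I_N, u i < l -> label_set u l = label_set v l
       & v i = st (label_set u (u i)) (label_set v (u i)) u i]) ->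
  odd_walks_long E g.+2.
Proof.
move=> odg longD ED EF FP s es ods.
have em : cycle D (map (fun w : {ffun _} => w i) s).
  exact: (homo_cycle (e := E)) es.
have gs : g <= size s.
  by rewrite -(size_map (fun w : {ffun _} => w i) s) longD ?size_map.
rewrite leqNgt; apply/negP => sg.
have {gs sg} sg : size s <= g by move: gs sg ods odg; lia.
have um := shortest_odd_walk_uniq longD em.
rewrite size_map in um; have {um} um := um ods sg.
have [u us umax] : exists2 u, u \in s & forall v, v \in s -> v i <= u i.
  case: s ods {es em sg um} => // a s _; elim: s a => [|b s IH] a.
    by exists a; rewrite ?mem_head // => v; rewrite inE => /eqP->.
  have [u us umax] := IH b; have [ua|au] := leqP (u i) (a i).
    exists a; rewrite ?mem_head // => v; rewrite inE => /predU1P[->//|/umax].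
    by move/leq_trans; apply.
  exists u; first by rewrite inE us orbT.
  by move=> v; rewrite inE => /predU1P[->|/umax//]; exact: ltnW.
have rs := rot_index us; move: (drop _ _ ++ _) rs => r rs.
have er : cycle E (u :: r) by rewrite -rs rot_cycle.
have : uniq (map (fun w : {ffun _} => w i) (u :: r)).
  by rewrite -rs map_rot rot_uniq.
have {}ods : odd (size (u :: r)) by rewrite -rs size_rot.
have rmax v : v \in r -> v i <= u i.
  by move=> vr; apply: umax; rewrite -(mem_rot (index u s)) rs inE vr orbT.
move=> /= /andP[ur um'].
have {rmax} rlt v : v \in r -> v i < u i.
  move=> vr; rewrite ltn_neqAle rmax // andbT; apply: contraNneq ur => /val_inj <-.
  exact: map_f.
have Fu v : v \in r -> F u v \/ F v u -> F u v.
  by move=> /rlt vu [//|/FP[]]; rewrite ltnNge (ltnW vu).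
(* Steps of the walk away from [u] only involve labels below [u i]. *)
have keep x y : x \in r -> y \in r -> E x y ->
    label_set x (u i) = label_set y (u i).
  move=> /rlt xr /rlt yr /EF[/FP[_ same _]|/FP[_ same _]]; first exact: same.
  by rewrite same.
case: r er ods um' {rs ur} rlt Fu keep => [|v r].
  by rewrite /= andbT => /EF[] /FP[]; rewrite ltnn.
rewrite /= rcons_path => /and3P[Euv Ervr Elu] ods /andP[vr _] rlt Fu keep.
have lr : last v r \in v :: r by exact: mem_last.
have [_ _ v_st] := FP _ _ (Fu v (mem_head _ _) (EF _ _ Euv)).
have [_ _ l_st] := FP _ _ (Fu _ lr (proj1 (or_comm _ _) (EF _ _ Elu))).
have same a p : path E a p -> {subset a :: p <= v :: r} ->
    label_set a (u i) = label_set (last a p) (u i).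
  elim: p a => [|b p IH] a //= /andP[Eab Ep] sub.
  rewrite (keep a b) ?sub ?inE ?eqxx ?orbT //; apply: IH => // x xp.
  by apply: sub; rewrite inE xp orbT.
have vl : v i = last v r i by rewrite v_st l_st (same v r).
case: r ods vr vl {lr v_st l_st same Ervr Elu rlt Fu keep} => // b r _ /negP vr vl.
have lr : last v (b :: r) \in b :: r by exact: (mem_last b r).
by case: vr; rewrite vl; exact: (map_f (fun w : {ffun _} => w i) lr).
Qed.

(** The same strategies must serve the pairs [(u, v)] and [(v, u)], since the
edges are not oriented; so they are chosen once for each unordered pair of
sets, oriented by rank. *)
Lemma consistent_strategies (I : finType) K m h : m <= h ->
  1 < K -> hat_bound K m h ->
  exists st : {set I} -> {set I} -> {ffun I -> 'I_K} -> I -> 'I_K,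
    forall A B, h <= #|A :\: B| -> h <= #|B :\: A| ->
    forall u v : {ffun I -> 'I_K},
    (exists2 i, i \in A :\: B & v i = st A B u i) \/
    (exists2 i, i \in B :\: A & u i = st B A v i).
Proof.
move=> mh K1 small.
pose idle (u : {ffun I -> 'I_K}) : I -> 'I_K := u.
have [PQ PQP] : exists PQ : {set I} * {set I} ->
    ({ffun I -> 'I_K} -> I -> 'I_K) * ({ffun I -> 'I_K} -> I -> 'I_K),
    forall AB, h <= #|AB.1 :\: AB.2| -> h <= #|AB.2 :\: AB.1| ->
    forall u v : {ffun I -> 'I_K},
    (exists2 i, i \in AB.1 :\: AB.2 & v i = (PQ AB).1 u i) \/
    (exists2 i, i \in AB.2 :\: AB.1 & u i = (PQ AB).2 v i).
  apply: (@fin_all_exists _ (fun=> _) (fun AB PQ => h <= #|AB.1 :\: AB.2| ->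
     h <= #|AB.2 :\: AB.1| -> forall u v : {ffun I -> 'I_K},
    (exists2 i, i \in AB.1 :\: AB.2 & v i = PQ.1 u i) \/
    (exists2 i, i \in AB.2 :\: AB.1 & u i = PQ.2 v i))) => -[A B] /=.
  have [hA|nhA] := leqP h #|A :\: B|; last first.
    by exists (idle, idle).
  have [hB|nhB] := leqP h #|B :\: A|; last first.
    by exists (idle, idle).
  have [P [Q PQ]] := hat_strategies K1 small hA (leq_trans mh hB).
  by exists (P, Q) => _ _ u v; apply: PQ.
exists (fun A B =>
  if enum_rank A < enum_rank B then (PQ (A, B)).1 else (PQ (B, A)).2).
move=> A B hA hB u v /=.
case: (ltngtP (enum_rank A) (enum_rank B)) => [AB|BA|/val_inj/enum_rank_inj AB].
- exact: (PQP (A, B)).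
- by have [] := PQP (B, A) hB hA v u; [right | left].
(* Equal sets have no difference, so [h = 0], which the bound excludes. *)
- move: hA mh small; rewrite /hat_bound AB setDv cards0 leqn0 => /eqP->; rewrite leqn0 => /eqP->.
  by rewrite !mul0n !expn0.
Qed.

Definition long_coloring (X C : finType) g (c : X -> X -> C) :=
  (forall x y, c x y = c y x) /\
  forall t, odd_walks_long [rel x y | (x != y) && (c x y == t)] g.

(** The largest label whose label sets in [u] and [v] differ gives two sets that
are far apart, and a correct guess of the game on them gives a position [i]
of the kind that [recolored_walks_long] needs. *)
Lemma recoloring (I C : finType) N g m h (c : 'I_N -> 'I_N -> C)
    (V : {set {ffun I -> 'I_N}}) :
  odd g -> 0 < #|I| -> m <= h -> 1 < N ->
  hat_bound N m h ->
  spread h V ->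
  long_coloring g c ->
  exists c' : {w | w \in V} -> {w | w \in V} -> I * C, long_coloring g.+2 c'.
Proof.
move=> odg /card_gt0P[i0 _] mh N1 small code [cC clong].
have [st stP] := consistent_strategies I mh N1 small.
pose F i : rel {ffun I -> 'I_N} := fun u v =>
  [&& [forall l : 'I_N, (u i < l) ==> (label_set u l == label_set v l)],
      v i != u i & v i == st (label_set u (u i)) (label_set v (u i)) u i].
have FP i u v : F i u v ->
    [/\ v i < u i, forall l : 'I_N, u i < l -> label_set u l = label_set v l
      & v i = st (label_set u (u i)) (label_set v (u i)) u i].
  case/and3P => /forallP same vu /eqP ust.
  have {}same (l : 'I_N) : u i < l -> label_set u l = label_set v l.
    by move=> ul; apply/eqP/(implyP (same l)).
  split=> //; rewrite ltnNge leq_eqVlt eq_sym [_ == _](negPf vu) /=.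
  apply/negP => uv; have /setP/(_ i) := same _ uv.
  by rewrite !inE eqxx eq_sym (negPf vu).
have FE u v : u \in V -> v \in V -> u != v -> exists i, F i u v || F i v u.
  move=> uV vV uv.
  have [j0 j0P] : exists j, label_set u j != label_set v j.
    apply/existsP; rewrite -negb_forall; apply: contraNN uv => /forallP same.
    apply/eqP/ffunP => i; have /eqP/setP/(_ i) := same (u i).
    by rewrite !inE eqxx => /esym/eqP.
  case: (@arg_maxnP _ j0 (fun j => label_set u j != label_set v j) val j0P).
  move=> j uvj jmax.
  have same (l : 'I_N) : j < l -> label_set u l = label_set v l.
    by move=> jl; apply: contraTeq jl => /jmax; rewrite -leqNgt.
  have [e|[hu hv]] := code u v uV vV j; first by rewrite e eqxx in uvj.
  have [[i]|[i]] := stP _ _ hu hv u v; rewrite !inE => /andP[nj /eqP ij] e.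
    exists i; apply/orP; left; rewrite /F ij e eqxx -e nj !andbT.
    by apply/forallP => l; apply/implyP => /same->.
  exists i; apply/orP; right; rewrite /F ij e eqxx -e nj !andbT.
  by apply/forallP => l; apply/implyP => /same->.
(* The default [i0] only serves the pairs of equal words. *)
pose p u v := odflt i0 [pick i | F i u v || F i v u].
have pC u v : p u v = p v u.
  by rewrite /p; congr odflt; apply: eq_pick => i; rewrite orbC.
exists (fun x y => let i := p (val x) (val y) in (i, c (val x i) (val y i))).
split=> [x y /=|[i t]]; first by rewrite pC cC.
pose E : rel {ffun I -> 'I_N} := fun u v =>
  (u i != v i) && (c (u i) (v i) == t) && (F i u v || F i v u).
apply: (odd_walks_long_hom (e' := E) (h := val)).
  move=> x y /= /andP[xy]; rewrite xpair_eqE => /andP[/eqP pi]; rewrite pi => ct.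
  have Fi : F i (val x) (val y) || F i (val y) (val x).
    move: pi; rewrite /p; case: pickP => [i' Fi' /= <- // | none].
    by have [i'] := FE _ _ (valP x) (valP y) xy; rewrite none.
  rewrite /E Fi ct !andbT.
  by case/orP: Fi => /and3P[_ ? _] //; rewrite eq_sym.
apply: (recolored_walks_long (i := i) odg (clong t) _ _ (FP i)).
  by move=> u v /andP[].
by move=> u v /andP[_ /orP].
Qed.

Lemma long_coloring_transport (X Y C D : finType) g (c : X -> X -> C) :
  #|Y| <= #|X| -> #|C| <= #|D| -> long_coloring g c ->
  exists d : Y -> Y -> D, long_coloring g d.
Proof.
move=> YX CD [cC clong].
pose h (y : Y) : X := enum_val (widen_ord YX (enum_rank y)).
have hI : injective h.
  by move=> x y /enum_val_inj/(congr1 val)/= /val_inj/enum_rank_inj.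
pose k (t : C) : D := enum_val (widen_ord CD (enum_rank t)).
have kI : injective k.
  by move=> x y /enum_val_inj/(congr1 val)/= /val_inj/enum_rank_inj.
exists (fun x y => k (c (h x) (h y))); split=> [x y|t]; first by rewrite cC.
case: (pickP (fun s => k s == t)) => [s /eqP <- | none].
  apply: (odd_walks_long_hom (h := h) _ (clong s)) => x y /=.
  by rewrite (inj_eq kI) (inj_eq hI).
by case=> // x [|y s] /=; rewrite none ?andbF.
Qed.

(** A class with first differing position [i] maps to a class of the old
colouring by taking the letter at [i]. *)
Lemma long_coloring_power (X C : finType) g a (c : X -> X -> C) :
  0 < a -> long_coloring g c ->
  exists d : {ffun 'I_a -> X} -> {ffun 'I_a -> X} -> 'I_a * C, long_coloring g d.
Proof.
case: a => // a _ [cC clong].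
pose p (u v : {ffun 'I_a.+1 -> X}) := odflt ord0 [pick i | u i != v i].
have pC u v : p u v = p v u.
  by rewrite /p; congr odflt; apply: eq_pick => i; rewrite eq_sym.
exists (fun u v => (p u v, c (u (p u v)) (v (p u v)))).
split=> [x y|[i t]]; first by rewrite pC cC.
apply: (odd_walks_long_hom (h := fun u : {ffun _} => u i) _ (clong t)) => u v /=.
case/andP => uv; rewrite xpair_eqE => /andP[/eqP <-] ->; rewrite andbT.
rewrite /p; case: pickP => //= same.
case/negP: uv; apply/eqP/ffunP => j; apply/eqP; exact: negbFE (same j).
Qed.

Lemma long_coloring_trivial (X : finType) :
  long_coloring 3 (fun _ _ : X => ord0 : 'I_1).
Proof.
by split=> // t [|x [|y [|z s]]] //=; rewrite eqxx.
Qed.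

Lemma bernoulli_exp a K : a ^ K.+1 + K.+1 * a ^ K <= a.+1 ^ K.+1.
Proof.
elim: K => [|K IH]; first by rewrite !expn0 !expn1 mul1n addn1.
rewrite [a.+1 ^ _]expnS; apply: leq_trans (leq_mul (leqnn _) IH).
rewrite !expnS; lia.
Qed.

Lemma double_pred_exp K : 0 < K -> 2 * K.-1 ^ K <= K ^ K.
Proof.
case: K => // K _ /=; apply: leq_trans (bernoulli_exp K K).
by rewrite mul2n -addnn leq_add2l expnS leq_mul2r leqnSn orbT.
Qed.

(** Since [K.-1 ^ K <= K ^ K / 2], the factor [K.-1 ^ (h * m.+1)] gains
[2 ^ (2 * b * m.+1 ^ 2)] over [K ^ (h * m.+1)], which beats the factor
[K ^ (h + m * m.+1) <= 2 ^ (2 * b * m * m.+1)]. *)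
Lemma hat_parameters K b m h :
  1 < K -> 0 < b -> K <= 2 ^ b -> m = 2 * b * K -> h = K * (2 * b * m.+1) ->
  m <= h /\ hat_bound K m h.
Proof.
move=> K1 b0 Kb em eh; split; first by rewrite eh em; nia.
rewrite /hat_bound.
pose q := 2 * b * m.+1 ^ 2.
have hq : h * m.+1 = K * q by rewrite eh /q; lia.
have q0 : 0 < q by rewrite /q !muln_gt0 b0.
rewrite hq !(expnM _ K q); apply: leq_trans (_ : (2 * K.-1 ^ K) ^ q <= _); last first.
  by rewrite leq_exp2r // double_pred_exp // ltnW.
rewrite expnMn ltn_pmul2r; last by rewrite !expn_gt0; case: (K) K1 => // [[]].
apply: (@leq_ltn_trans ((2 ^ b) ^ (h + m * m.+1))).
  by case: (h + _) => // e; rewrite leq_exp2r.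
by rewrite -expnM ltn_exp2l // /q eh em; nia.
Qed.

Definition has_long_coloring N T g :=
  exists c : 'I_N -> 'I_N -> 'I_T, long_coloring g c.

Lemma has_long_coloring_base N : has_long_coloring N 1 3.
Proof. by eexists; exact: long_coloring_trivial. Qed.

Lemma has_long_coloring_power a N T g :
  0 < a -> has_long_coloring N T g -> has_long_coloring (N ^ a) (a * T) g.
Proof.
move=> a0 [c /(long_coloring_power a0)[d dP]].
by apply: long_coloring_transport dP; rewrite ?card_ffun ?card_prod ?card_ord.
Qed.

Lemma has_long_coloring_step N T g n m h :
  odd g -> 0 < n -> m <= h -> 1 < N ->
  hat_bound N m h ->
  has_long_coloring N T g ->
  exists N', [/\ has_long_coloring N' (n * T) g.+2, N' <= N ^ n
                & N ^ n <= N' * (n.+1 ^ h.*2.+2) ^ N].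
Proof.
move=> odg n0 mh N1 small [c cP].
have [|V [Vbig code]] := @exists_code 'I_n N h; first by rewrite card_ord.
rewrite card_ord in Vbig.
exists #|V|; split=> //; last first.
  by rewrite (leq_trans (max_card _)) // card_ffun !card_ord.
have [|c' c'P] := recoloring odg _ mh N1 small code cP; first by rewrite card_ord.
by apply: long_coloring_transport c'P; rewrite ?card_prod ?card_sig ?card_ord.
Qed.

(** * Growth of the number of vertices *)
Local Open Scope ring_scope.

Lemma ln_le_affine (R : realType) (a x : R) : 0 < a -> 0 < x -> ln x <= a * x - ln a.
Proof.
move=> a0 x0; have := ln_sublinear (mulr_gt0 a0 x0).
by rewrite lnM ?posrE //; lra.
Qed.

Lemma eventually_ln_le (R : realType) (A a : R) : 0 < a ->
  exists x0, 1 <= x0 /\ forall x, x0 <= x -> A + 2 * ln x <= a * x.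
Proof.
move=> a0; have b0 : 0 < a / 4 by lra.
exists (1 + `|A - 2 * ln (a / 4)| / (a / 2)); split=> [|x xx].
  by rewrite lerDl divr_ge0 //; lra.
have x1 : 1 + `|A - 2 * ln (a / 4)| / (a / 2) >= 1.
  by rewrite lerDl divr_ge0 //; lra.
have := ln_le_affine b0 (lt_le_trans ltr01 (le_trans x1 xx)).
have : `|A - 2 * ln (a / 4)| / (a / 2) <= x by lra.
rewrite ler_pdivrMr; last lra.
have := ler_norm (A - 2 * ln (a / 4)); lra.
Qed.

Lemma ln2_bounds (R : realType) : 1 / 2 <= ln (2 : R) <= 1.
Proof.
apply/andP; split; last by have := @le_ln1Dx R 1; rewrite -natr1; apply; lra.
have := @le_ln1Dx R (- (1 / 2)); have -> : 1 - 1 / 2 = (2 : R)^-1 by lra.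
by rewrite lnV ?posrE // => /(_ ltac:(lra)); lra.
Qed.

Lemma ler_ln_nat (R : realType) (p q : nat) :
  (0 < p)%N -> (p <= q)%N -> ln (p%:R : R) <= ln q%:R.
Proof.
by move=> p0 pq; rewrite ler_ln ?posrE ?ltr0n ?ler_nat // (leq_trans p0).
Qed.

Lemma up_log_le_ln (R : realType) N : (1 < N)%N ->
  (up_log 2 N)%:R <= 1 + 2 * ln (N%:R : R).
Proof.
move=> N1; have /andP[l2 _] := ln2_bounds R.
have lo : (2 ^ (up_log 2 N).-1 < N)%N by exact: up_log_gtn.
have -> : up_log 2 N = (up_log 2 N).-1.+1 by rewrite prednK // up_log_gt0.
set c := (up_log 2 N).-1 in lo *.
have : ln ((2 ^ c)%:R : R) <= ln N%:R.
  by apply: ler_ln_nat (ltnW lo); rewrite expn_gt0.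
rewrite natrX lnXn // -(mulr_natr (ln _) c) -(natr1 c).
have : (0 : R) <= c%:R by exact: ler0n.
nra.
Qed.

(** With [x = ln N], [b] about [x] and [h] about [(b * N) ^ 2], words of length
[n = N * L * h.+1] are used.  Restricting to a code loses a factor
[n.+1 ^ (2 * N * h.+1) = n.+1 ^ (2 * n / L)], which is at most
[N ^ (10 * n / L)] because [ln n.+1 <= 5 * x]; this dictates [L > 10 / d]. *)
Lemma long_coloring_growth (R : realType) (d : R) : 0 < d -> d <= 1 ->
  exists x0 : R, 1 <= x0 /\ forall N T g, odd g -> x0 <= ln (N%:R : R) ->
    has_long_coloring N T g ->
    exists n N', [/\ has_long_coloring N' (n * T) g.+2, (2 <= n)%N,
      (1 - d) * n%:R * ln N%:R <= ln (N'%:R : R),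
      ln (N'%:R : R) <= n%:R * ln N%:R & ln (n%:R : R) <= (3 + d) * ln N%:R].
Proof.
move=> d0 d1; pose L := (truncn (10 / d)).+1.
have Ld : 10 < d * L%:R.
  by have := truncnS_gt (10 / d); rewrite ltr_pdivrMr // mulrC.
have [x0 [x01 x0P]] := eventually_ln_le (ln (7 * L%:R) + 2 * ln 3) d0.
exists x0; split=> // N T g odg; set x := ln _ => x0x col.
have x1 : 1 <= x by lra.
have N1 : (1 < N)%N.
  rewrite ltnNge; apply/negP => N1; move: x1; rewrite /x.
  by rewrite leNgt (le_lt_trans _ ltr01) // ln_le0 // (ler_nat _ N 1).
have Npos : 0 < N%:R :> R by rewrite ltr0n ltnW.
pose b := up_log 2 N; have b0 : (0 < b)%N by rewrite up_log_gt0.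
have bx : b%:R <= 3 * x by have := up_log_le_ln R N1; rewrite -/b -/x; lra.
pose m := (2 * b * N)%N; pose h := (N * (2 * b * m.+1))%N.
have [mh small] := hat_parameters N1 b0 (up_logP N (isT : 1 < 2)%N) (erefl m) (erefl h).
pose n := (N * L * h.+1)%N.
have n2 : (2 <= n)%N by rewrite /n -mulnA (leq_trans N1) // leq_pmulr.
have [N' [col' N'up count]] := has_long_coloring_step odg (ltnW n2) mh N1 small col.
have npos : 0 < n%:R :> R by rewrite ltr0n ltnW.
have N'0 : (0 < N')%N.
  by rewrite lt0n; apply: contraTneq count => ->; rewrite mul0n -ltnNge expn_gt0 ltnW.
have lnn : ln (n%:R : R) <= (3 + d) * x.
  have : (n <= 7 * L * (b * b * (N * N * N)))%N.
    have y0 : (0 < b * N)%N by rewrite muln_gt0 b0 ltnW.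
    have hy : (h.+1 <= 7 * ((b * N) * (b * N)))%N.
      have -> : h = ((2 * (b * N)) * (2 * (b * N)).+1)%N.
        by rewrite /h /m; move: (b) (N); clear; lia.
      by move: y0; move: (b * N)%N; clear; nia.
    apply: leq_trans (leq_mul (leqnn _) hy) _.
    by move: (L) (b) (N); clear; lia.
  move=> /(ler_ln_nat R (ltnW n2))/le_trans; apply; rewrite !natrM.
  rewrite !lnM ?posrE ?mulr_gt0 ?ltr0n ?(ltnW N1) // -/x.
  have := x0P x x0x; rewrite lnM ?posrE ?ltr0n //.
  have : ln (b%:R : R) <= ln (3 * x).
    by rewrite ler_ln ?posrE ?ltr0n // mulr_gt0 //; lra.
  rewrite lnM ?posrE //; last lra.
  lra.
exists n, N'; split=> //; last first.
  rewrite -/x mulr_natl -lnXn // ler_ln ?posrE ?ltr0n ?exprn_gt0 //.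
  by rewrite -natrX ler_nat.
have lnn1 : ln (n.+1%:R : R) <= 5 * x.
  have : ln (n.+1%:R : R) <= ln (2 * n%:R : R).
    by rewrite -natrM ler_ln_nat // mul2n -addnn -addn1 leq_add2l ltnW.
  rewrite lnM ?posrE //; have /andP[_] := ln2_bounds R; nra.
have {count} := ler_ln_nat R _ count; rewrite expn_gt0 (ltnW N1) => /(_ isT).
rewrite natrM !natrX lnM ?posrE ?exprn_gt0 ?ltr0n // !lnXn ?exprn_gt0 ?ltr0n ?(ltnW N1) //.
rewrite -/x -!mulrnA -(mulr_natr x) -(mulr_natr (ln _)).
have : (h.*2.+2 * N * L)%:R = (2 * n)%:R :> R 
  by congr _%:R; rewrite /n; move: (L) (N) (h); clear; lia.
rewrite (natrM _ _ L) (natrM _ 2); set s := (h.*2.+2 * N)%:R => sL count.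
have s0 : 0 <= s by exact: ler0n.
have l0 : 0 < L%:R :> R by rewrite ltr0n.
have sd : 5 * s <= d * n%:R by nra.
rewrite mulrAC; nra.
Qed.
Lemma ln_le_half (R : realType) (x : R) : 0 < x -> ln x <= x / 2.
Proof.
move=> x0; have := @le_ln1Dx R (x / 2 - 1).
rewrite addrCA subrr addr0 ln_div ?posrE // => /(_ ltac:(lra)).
by have /andP[_] := ln2_bounds R; lra.
Qed.

(** The induction starts from one colour on slightly more than
[k ^ (1 + eps / 20)] vertices; this surplus absorbs the factors [1 - d] lost
in the steps.  The first step takes [ln N] from [ln k] to a power of [k] with
exponent close to 3, and each later one costs one exponential; the constant
[K] is kept in front of [ln N] so that [K * ln N] dominates
[ln (K * N ^ 4 * ln N)]. *)
Lemma long_coloring_tower (R : realType) (eps d K : R) :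
  0 < eps -> eps <= 1 -> 0 < d -> d <= eps / 20 -> 10 <= K ->
  exists k1 : nat, forall k i, (k1 <= k)%N -> exists N T,
    [/\ has_long_coloring N T (2 * i + 5), 1 <= ln (N%:R : R),
        (1 - d) ^+ i.+1 * (1 + eps / 20) * T%:R * ln k%:R <= ln (N%:R : R)
      & K * ln (N%:R : R) <= iter i (@expR R) (k%:R `^ (3 + eps))].
Proof.
move=> e0 e1 d0 de K10.
have [x1 [x11 growth]] := @long_coloring_growth R d d0 (ltac:(lra)).
have [x2 [x21 lnx]] := @eventually_ln_le R 0 (2 * d) (ltac:(lra)).
pose x0 := Num.max x1 x2.
have log_bound n (x x' : R) : (2 <= n)%N -> x0 <= x -> 0 < x' -> x' <= n%:R * x ->
    ln (n%:R : R) <= (3 + d) * x -> ln (K * x') <= ln K + (3 + 2 * d) * x.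
  move=> n2; rewrite ge_max => /andP[_ x2x] x'0 x'n lnn.
  have n0 : 0 < n%:R :> R by rewrite ltr0n ltnW.
  have xp : 0 < x by lra.
  have : ln x' <= ln (n%:R * x) by rewrite ler_ln ?posrE ?mulr_gt0.
  have := lnx x x2x; rewrite !lnM ?posrE //; lra.
have grows n (x x' : R) : (2 <= n)%N -> 1 <= x -> (1 - d) * n%:R * x <= x' -> x <= x'.
  rewrite -(ler_nat R) => n2 xp /(le_trans _); apply.
  have n1 : 1 <= (1 - d) * n%:R by nra.
  by rewrite ler_peMl //; lra.
pose Y : R := x0 + 20 / eps + ln K / (eps / 4).
exists (truncn (expR Y)).+1 => k i kY; set y := ln (k%:R : R).
have k0 : 0 < k%:R :> R by rewrite ltr0n (leq_trans _ kY).
have Yy : Y <= y.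
  rewrite -[Y]expRK ler_ln ?posrE ?expR_gt0 //.
  by apply: le_trans (ltW (truncnS_gt _)) _; rewrite ler_nat.
have lK0 : 0 <= ln K by rewrite ln_ge0 //; lra.
have x01 : 1 <= x0 by rewrite le_max x11.
have [y0 y1 y2] : [/\ x0 <= y, 20 / eps <= y & ln K / (eps / 4) <= y].
  have a0 : 0 <= 20 / eps by rewrite divr_ge0 ?ltW.
  have b0 : 0 <= ln K / (eps / 4) by rewrite divr_ge0 //; lra.
  by move: Yy; rewrite /Y; split; lra.
rewrite ler_pdivrMr // in y1; rewrite ler_pdivrMr ?divr_gt0 // in y2.
suff tower m : exists N T,
    [/\ has_long_coloring N T (2 * m + 5), x0 <= ln (N%:R : R),
        (1 - d) ^+ m.+1 * (1 + eps / 20) * T%:R * y <= ln (N%:R : R)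
      & K * ln (N%:R : R) <= iter m (@expR R) (k%:R `^ (3 + eps))].
  by have [N [T [? ? ? ?]]] := tower i; exists N, T; split=> //; lra.
elim: m {i} => [|i [N [T [col x0x tx Kx]]]].
  pose N := (truncn (k%:R `^ (1 + eps / 20) : R)).+1.
  have p1 : 1 <= k%:R `^ (1 + eps / 20) :> R.
    have -> : k%:R `^ (1 + eps / 20) = expR ((1 + eps / 20) * y) by rewrite /powR gt_eqF.
    have := expR_ge1Dx ((1 + eps / 20) * y); nra.
  have yx : (1 + eps / 20) * y <= ln (N%:R : R).
    by rewrite -ln_powR ler_ln ?posrE ?powR_gt0 // ltW ?truncnS_gt.
  have xy : ln (N%:R : R) <= (1 + eps / 10) * y.
    have : ln (N%:R : R) <= ln (2 * k%:R `^ (1 + eps / 20)).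
      rewrite ler_ln ?posrE ?mulr_gt0 ?powR_gt0 // /N -natr1.
      have := truncn_le (k%:R `^ (1 + eps / 20) : R); rewrite (le_trans ler01 p1) => tr.
      lra.
    rewrite lnM ?posrE ?powR_gt0 // ln_powR -/y.
    have /andP[_] := ln2_bounds R; nra.
  have xN : x0 <= ln (N%:R : R) by nra.
  have [||n [N' [col' n2 lo up lnn]]] := growth N 1%N 3 _ _ (has_long_coloring_base N).
  - by [].
  - by move: xN; rewrite ge_max => /andP[].
  exists N', (n * 1)%N; have xx' := grows _ _ _ n2 (le_trans x01 xN) lo.
  split=> //.
  - exact: le_trans xx'.
  - apply: le_trans lo; rewrite muln1 expr1.
    have -> : (1 - d) * (1 + eps / 20) * n%:R * y =
      (1 - d) * n%:R * ((1 + eps / 20) * y) by ring.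
    by rewrite ler_wpM2l // mulr_ge0 //; lra.
  have x'0 : 0 < ln (N'%:R : R) by lra.
  have lb := log_bound _ _ _ n2 xN x'0 up lnn.
  rewrite /= -[K * _]lnK ?posrE ?mulr_gt0 //; last lra.
  have -> : k%:R `^ (3 + eps) = expR ((3 + eps) * y) by rewrite /powR gt_eqF.
  rewrite ler_expR; apply: le_trans lb _.
  have a1 : (3 + 2 * d) * ln N%:R <= (3 + eps / 10) * ((1 + eps / 10) * y).
    by apply: ler_pM => //; lra.
  have yp : 0 <= y by lra.
  have a2 : 0 <= (1 - eps) * (eps * y) by rewrite !mulr_ge0 //; lra.
  have a3 : 0 <= eps * y by rewrite mulr_ge0 // ltW.
  lra.
have x1x : 1 <= ln (N%:R : R) by lra.
have [||n [N' [col' n2 lo up lnn]]] := growth N T (2 * i + 5)%N _ _ col.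
- by rewrite oddD oddM.
- by move: x0x; rewrite ge_max => /andP[].
have xx' := grows _ _ _ n2 x1x lo.
exists N', (n * T)%N; split=> //.
- have -> : (2 * i.+1 + 5 = (2 * i + 5).+2)%N by rewrite mulnS.
  exact: col'.
- exact: le_trans xx'.
- apply: le_trans lo; rewrite natrM exprS; move: tx; set q := _ ^+ _ => tx.
  have -> : (1 - d) * q * (1 + eps / 20) * (n%:R * T%:R) * y =
     (1 - d) * n%:R * (q * (1 + eps / 20) * T%:R * y) by ring.
  by rewrite ler_wpM2l // mulr_ge0 //; lra.
have x'0 : 0 < ln (N'%:R : R) by lra.
have lb := log_bound _ _ _ n2 x0x x'0 up lnn.
rewrite /= -[K * ln N'%:R]lnK ?posrE ?mulr_gt0 //; last lra.
rewrite ler_expR; apply: le_trans lb (le_trans _ Kx).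
set x := ln N%:R in x1x *.
have a1 : 0 <= (K - 10) * x by rewrite mulr_ge0 //; lra.
have a2 : 0 <= K * (x - 1) by rewrite mulr_ge0 //; lra.
have a3 : 0 <= (1 - d) * x by rewrite mulr_ge0 //; lra.
have a4 : ln K <= K / 2 by apply: ln_le_half; lra.
lra.
Qed.

Lemma bernoulli_sub (R : realType) (d : R) n :
  0 <= d -> d <= 1 -> 1 - n%:R * d <= (1 - d) ^+ n.
Proof.
move=> d0 d1; elim: n => [|n IH]; first by rewrite mul0r subr0 expr0.
have n0 : 0 <= n%:R :> R by exact: ler0n.
rewrite exprS -(natr1 n); apply: le_trans (ler_wpM2l _ IH); last by lra.
have : 0 <= n%:R * d * d by rewrite !mulr_ge0.
lra.
Qed.

Lemma iter_expR_homo (R : realType) i (x y : R) :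
  x <= y -> iter i (@expR R) x <= iter i (@expR R) y.
Proof. by move=> xy; elim: i => //= i IH; rewrite ler_expR. Qed.

(** Raise the colouring of [long_coloring_tower] to the least power [a] with
[C * M <= N0 ^ a].  Rounding [a] up costs a factor [1 + 1 / K] and [C] costs
[ln C], both small compared with the surplus factor [1 + eps / 40]; this
dictates the size of [K]. *)
Lemma few_long_classes (R : realType) (g : nat) (eps C : R) :
  (5 <= g)%N -> odd g -> 0 < eps -> 1 <= C ->
  exists k1 : nat, forall k (M : R), (k1 <= k)%N ->
    iter ((g - 3) %/ 2) (@expR R) (k%:R `^ (3 + eps)) <= C * M ->
    exists N T, [/\ has_long_coloring N T g, C * M <= N%:R & k%:R ^+ T < M].
Proof.
move=> g5 odg eps0 C1.
have [i ->] : exists i, g = (2 * i + 5)%N.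
  by exists (g - 5)./2; move: g5 odg; clear; lia.
have -> : ((2 * i + 5 - 3) %/ 2)%N = i.+1 by clear; lia.
pose e := Num.min eps 1.
have e0 : 0 < e by rewrite lt_min eps0 ltr01.
have [ee e1] : e <= eps /\ e <= 1 by rewrite !ge_min !lexx orbT.
pose d := e / (100 * i.+1%:R); pose r := e / 40.
have i0 : 1 <= i.+1%:R :> R by rewrite ler1n.
have dE : i.+1%:R * d = e / 100.
  by rewrite /d; move: i0; set z := i.+1%:R => z1; field; rewrite gt_eqF //; lra.
have d0 : 0 < d by rewrite divr_gt0 // mulr_gt0 // ltr0n.
have de : d <= e / 20.
  have : 0 <= (i.+1%:R - 1) * d by rewrite mulr_ge0 //; lra.
  by lra.
have qr : 1 + r <= (1 - d) ^+ i.+1 * (1 + e / 20).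
  have := bernoulli_sub i.+1 (ltW d0) (ltac:(lra)).
  rewrite dE => /(ler_wpM2r (_ : 0 <= 1 + e / 20)) => /(_ (ltac:(lra))).
  apply: le_trans; have : 0 <= e * (1 - e) by rewrite mulr_ge0 //; lra.
  by rewrite /r; lra.
have r0 : 0 < r by rewrite /r; lra.
have lC : 0 <= ln C by exact: ln_ge0.
pose B := (1 + r) * (ln C + 1).
have B1 : 1 <= B.
  have : 0 <= r * (ln C + 1) by rewrite mulr_ge0 //; lra.
  by rewrite /B; lra.
pose K := 10 + 4 / r * B.
have rK : 4 * B <= r * K.
  have -> : r * K = 10 * r + 4 * B by rewrite /K; field; rewrite gt_eqF.
  by rewrite lerDr; lra.
have K10 : 10 <= K.
  by rewrite lerDl mulr_ge0 ?divr_ge0 //; lra.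
have [k1 k1P] := long_coloring_tower e0 e1 d0 de K10.
exists k1.+1 => k M k1k bigM.
have [N0 [T0 [col x1 Tx Kx]]] := k1P k i (ltnW k1k).
set x := ln _ in x1 Tx Kx.
have k_ge1 : 1 <= k%:R :> R by rewrite ler1n (leq_trans _ k1k).
have {bigM Kx} bigM : expR (K * x) <= C * M.
  apply: le_trans bigM; rewrite /= ler_expR; apply: le_trans Kx _.
  by apply: iter_expR_homo; rewrite ler_powR // lerD2l.
have CM0 : 0 < C * M by apply: lt_le_trans bigM; exact: expR_gt0.
have M0 : 0 < M by move: CM0; rewrite pmulr_rgt0 //; lra.
set y := ln (C * M).
have Kxy : K * x <= y by rewrite -ler_expR /y lnK.
have xp : 0 < x by lra.
have xy : 4 * x <= r * y.
  have : r * (K * x) <= r * y by rewrite ler_wpM2l // ltW.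
  have : 4 * x <= 4 * B * x by rewrite ler_wpM2r //; lra.
  have : 4 * B * x <= r * K * x by rewrite ler_wpM2r //; lra.
  by lra.
have yB : 4 * B <= r * y.
  apply: le_trans rK _; rewrite (ler_wpM2l (ltW r0)) // (le_trans _ Kxy) //.
  by rewrite ler_peMr //; lra.
pose a := (truncn (y / x)).+1.
have ylt : y < a%:R * x by rewrite -ltr_pdivrMr // truncnS_gt.
have y0 : 0 <= y by rewrite (le_trans _ Kxy) // mulr_ge0 //; lra.
have ale : a%:R * x <= y + x.
  rewrite /a -natr1 mulrDl mul1r lerD2r -ler_pdivlMr //.
  by rewrite truncn_le divr_ge0 // ltW.
have N0p : 0 < N0%:R :> R.
  rewrite ltr0n lt0n; apply: contraTneq x1 => N00.
  by rewrite /x N00 ln0 // -ltNge.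
exists (N0 ^ a)%N, (a * T0)%N; split.
- exact: has_long_coloring_power.
- rewrite natrX -ler_ln ?posrE ?exprn_gt0 // lnXn // -/x -/y -mulr_natl.
  exact: ltW.
have kp : 0 < k%:R :> R by lra.
rewrite -ltr_ln ?posrE ?exprn_gt0 // lnXn //.
have -> : ln M = y - ln C by rewrite /y lnM ?posrE //; lra.
set l := ln (k%:R : R) in Tx *.
have l0 : 0 <= l by exact: ln_ge0.
have Tl : (1 + r) * (T0%:R * l) <= x.
  apply: le_trans Tx; rewrite -mulrA ler_wpM2r // mulr_ge0 //.
have : (1 + r) * (l *+ (a * T0)) <= a%:R * x.
  rewrite -(mulr_natl l) natrM.
  have -> : (1 + r) * (a%:R * T0%:R * l) = a%:R * ((1 + r) * (T0%:R * l)) by ring.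
  by rewrite ler_wpM2l.
set t := l *+ _ => tx.
have {}yB : 4 * ((1 + r) * ln C + 1 + r) <= r * y by move: yB; rewrite /B; lra.
have : (1 + r) * t < (1 + r) * (y - ln C) by lra.
by rewrite ltr_pM2l //; lra.
Qed.

(** * From colourings to subgraphs *)
Lemma graph_eq (V : finType) (G H : graph V) :
  vset G = vset H -> eset G = eset H -> G = H.
Proof.
case: G H => vG eG pG [vH eH pH] /= ev ee; case: _ / ev in pH *.
by case: _ / ee in pH *; congr Graph; exact: bool_irrelevance.
Qed.

Lemma edge_filter_subproof (V : finType) (G : graph V) (P : {set {set V}}) :
  [forall e in eset G :&: P, (e \subset vset G) && (#|e| == 2)].
Proof.
by apply/forall_inP => e /setIP[eG _]; exact: (forall_inP (esetP G)).
Qed.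

Definition edge_filter (V : finType) (G : graph V) (P : {set {set V}}) : graph V :=
  Graph (edge_filter_subproof G P).

(** The bound would fail for an empty union: [f] of an edgeless graph may
exceed 1. *)
Lemma edge_filter_bigcup_le (R : realType) (f : graph_parameter R) (V I : finType)
    (G : graph V) (P : I -> {set {set V}}) (k : R) (s : seq I) :
  (forall G1 G2 : graph V, vset G1 = vset G2 ->
     f V (graph_union G1 G2) <= f V G1 * f V G2) ->
  (forall i, f V (edge_filter G (P i)) <= k) -> (0 < size s)%N ->
  f V (edge_filter G (\bigcup_(i <- s) P i)) <= k ^+ size s.
Proof.
move=> f_union fk; case: s => // i s _; elim: s i => [|j s IH] i.
  by rewrite big_seq1.
rewrite big_cons exprS.
have -> : edge_filter G (P i :|: \bigcup_(t <- j :: s) P t) =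
    graph_union (edge_filter G (P i)) (edge_filter G (\bigcup_(t <- j :: s) P t)).
  by apply: graph_eq; rewrite /= ?finset.setUid ?finset.setIUr.
apply: le_trans (f_union _ _ _) _ => //.
by rewrite ler_pM ?gp_ge0.
Qed.

Lemma exists_proper_labelling (V : finType) (G : graph V) N :
  (chi G <= N)%N -> (0 < N)%N ->
  exists lam : V -> 'I_N, forall x y, adj G x y -> lam x != lam y.
Proof.
rewrite /chi; case: ex_minnP => n /existsP[c /forallP cP] _ nN N0.
pose lam (x : V) := if insub x is Some x' then widen_ord nN (c x') else Ordinal N0.
have adjV x y : adj G x y -> (x \in vset G) /\ (y \in vset G).
  move=> xy; have /andP[/fintype.subsetP sub _] := forall_inP (esetP G) _ xy.
  by split; apply: sub; rewrite !inE eqxx ?orbT.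
exists lam => x y xy; have [xG yG] := adjV x y xy.
rewrite /lam !insubT; apply: contraTneq (forallP (cP (Sub x xG)) (Sub y yG)).
by move=> e; rewrite negb_imply xy negbK -val_eqE; apply/eqP; exact: (congr1 val e).
Qed.

(** The graphs [edge_filter G (P t)] cover the edges of [G], and [lam] maps
each of them homomorphically into a colour class. *)
Lemma exists_long_class (R : realType) (f : graph_parameter R) (V : finType)
    (G : graph V) g N T (k : R) :
  (forall G1 G2 : graph V, vset G1 = vset G2 ->
     f V (graph_union G1 G2) <= f V G1 * f V G2) ->
  has_long_coloring N T g -> (0 < N)%N -> (chi G <= N)%N -> k ^+ T < f V G ->
  exists H : graph V, [/\ subgraph H G, k <= f V H & (g%:R%:E <= odd_girth R H)%E].
Proof.
move=> f_union [c [cC clong]] N0 chiN fG.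
have [lam lamP] := exists_proper_labelling chiN N0.
pose P (t : 'I_T) := [set e : {set V} |
  [exists x, exists y, (e == [set x; y]) && (c (lam x) (lam y) == t)]].
have adjP t x y : adj (edge_filter G (P t)) x y ->
    (lam x != lam y) && (c (lam x) (lam y) == t).
  rewrite /adj /= => /setIP[xy]; rewrite inE => /existsP[x' /existsP[y']].
  case/andP => /eqP e /eqP <-; rewrite (lamP _ _ xy) /=.
  have xy' : x != y by apply: contraTneq (lamP _ _ xy) => ->; rewrite eqxx.
  have := set21 x y; have := set22 x y; rewrite e !inE.
  move=> /orP[]/eqP yE /orP[]/eqP xE; rewrite -?yE -?xE //.
  - by rewrite xE yE eqxx in xy'.
  - by rewrite cC.
  - by rewrite xE yE eqxx in xy'.
have [t kt] : exists t, k <= f V (edge_filter G (P t)).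
  apply: contrapT => none; move: fG; rewrite ltNge => /negP; apply.
  have small t : f V (edge_filter G (P t)) <= k.
    by rewrite leNgt; apply/negP => /ltW kt; apply: none; exists t.
  have T0 : (0 < T)%N by apply: leq_ltn_trans (ltn_ord (c (Ordinal N0) (Ordinal N0))).
  have := edge_filter_bigcup_le f_union small (s := enum 'I_T).
  rewrite size_enum_ord => /(_ T0); congr (f V _ <= _).
  apply: graph_eq => //=; apply/finset.setIidPl/fintype.subsetP => e eG.
  have /andP[_ /cards2P[x [y [_ exy]]]] := forall_inP (esetP G) _ eG.
  rewrite big_enum /=; apply/finset.bigcupP; exists (c (lam x) (lam y)) => //.
  by rewrite inE; apply/existsP; exists x; apply/existsP; exists y; rewrite exy !eqxx.
exists (edge_filter G (P t)); split=> //.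
  by split=> //=; exact: finset.subsetIl.
apply/ereal_infP => _ /= [s /andP[/and3P[_ _ cyc] ods] <-].
rewrite lee_fin ler_nat; apply: odd_walks_long_hom (clong t) s cyc ods.
exact: adjP.
Qed.

Theorem theorem1p5 (R : realType) (f : graph_parameter R)
    (hf : chi_amenable f) (g : nat) (hg5 : (5 <= g)%N) (hgodd : odd g)
    (eps : R) (heps : 0 < eps) :
  exists k0 : nat, forall k : nat, (k0 <= k)%N ->
    forall (T : finType) (G : graph T),
      iter_exp ((g - 3) %/ 2)%N (k%:R `^ (3 + eps)) <= f T G ->
      exists G' : graph T,
        [/\ subgraph G' G, k%:R <= f T G' & (g%:R%:E <= odd_girth R G')%E].
Proof.
have [f_union [C [C1 f_chi]]] := hf.
have [k0 k0P] := few_long_classes hg5 hgodd heps C1.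
exists k0 => k kk0 T G fG.
have [H [[HGv HGe] fH chiH]] := f_chi T G.
have C0 : 0 < C by exact: lt_le_trans C1.
have [|N [t [col CMN kt]]] := k0P k (f T H) kk0.
  by apply: le_trans fG _; rewrite mulrC -ler_pdivrMr.
have fH0 : 0 < f T H by apply: le_lt_trans kt; rewrite exprn_ge0.
have N0 : (0 < N)%N by rewrite -(ltr_nat R) (lt_le_trans _ CMN) // mulr_gt0.
have chiN : (chi H <= N)%N by rewrite -(ler_nat R) (le_trans chiH).
have [G' [[Gv Ge] kG' gG']] := exists_long_class (f_union T) col N0 chiN kt.
exists G'; split=> //; split.
- exact: fintype.subset_trans Gv HGv.
- exact: fintype.subset_trans Ge HGe.
Qed.
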